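(* Let $M$ be a $(2n+1)$-dimensional $N(\kappa)$-contact metric manifold which is $\xi$-$\mathcal{T}$-flat, i.e. $\mathcal{T}(X_1,X_2)\xi=0$ for all vector fields $X_1,X_2$, and suppose $a_4\neq0$. Then $$S=\Bigl(\frac{-A_3}{a_4}\Bigr)g+\Bigl(\frac{-B_3}{a_4}\Bigr)\eta\otimes\eta,$$ where $A_3=a_0\kappa+2n\kappa a_1+2n(2n-2+\kappa)a_7$ and $B_3=-a_0\kappa+2n\kappa(a_2+a_3+a_5+a_6)-2n(2n-2+\kappa)a_7$. Therefore $M$ is an $\eta$-Einstein manifold. Consequently, for $\mathcal{T}$ equal to each of the following special tensors (with $a_4\ne0$), $\xi$-flatness implies that $S$ has the stated form (so $M$ is Einstein when $S$ is a multiple of $g$, and $\eta$-Einstein otherwise): - $\mathcal{C}_\star$: $S=\dfrac{\frac{(\kappa+2n-2)(4na_1+a_0)}{2n+1}-2n\kappa a_1-\kappa a_0}{a_1}\,g+\dfrac{2((\kappa-1)n+1)(4na_1+a_0)}{(2n+1)a_1}\,\eta\otimes\eta$; - $\mathcal{C}$: $S=(2n-2)g+2(n\kappa-n+1)\eta\otimes\eta$; - $\mathcal{L}$: $S=-\kappa g+(2n\kappa+\kappa)\eta\otimes\eta$; - $\mathcal{M},\mathcal{W}_2,\mathcal{W}_9$: $S=2n\kappa\,g$; - $\mathcal{W}_3$: $S=-2n\kappa\,g+4n\kappa\,\eta\otimes\eta$; - $\mathcal{W}_7$: $S=2n\kappa\,\eta\otimes\eta$.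
   Context: A contact metric manifold $(M^{2n+1},\varphi,\xi,\eta,g)$ satisfies $\varphi^2=-I+\eta\otimes\xi$, $\eta(\xi)=1$, $\varphi\xi=0$, $\eta\circ\varphi=0$, $g(\varphi X,\varphi Y)=g(X,Y)-\eta(X)\eta(Y)$, $d\eta(X,Y)=g(X,\varphi Y)$; put $h=\tfrac12\mathcal{L}_\xi\varphi$. It is an $N(\kappa)$-contact metric manifold ($\kappa$ a real constant) if $R(X,Y)\xi=\kappa[\eta(Y)X-\eta(X)Y]$ for all $X,Y$, where $R(X,Y)Z=\nabla_X\nabla_YZ-\nabla_Y\nabla_XZ-\nabla_{[X,Y]}Z$. $S$, $Q$, $r$ denote the Ricci tensor, the Ricci operator ($S(X,Y)=g(QX,Y)$) and the scalar curvature. $M$ is $\eta$-Einstein if $S=b_1g+b_2\,\eta\otimes\eta$ with $b_1,b_2$ smooth functions, and Einstein if moreover $b_2=0$. Standing formulas the paper uses for every $N(\kappa)$-contact metric manifold considered: $S(X,Y)=2(n-1)g(X,Y)+2(n-1)g(hX,Y)+[2n\kappa-2(n-1)]\eta(X)\eta(Y)$, $S(X,\xi)=2n\kappa\,\eta(X)$, $r=2n(2n-2+\kappa)$. The $\mathcal{T}$-curvature tensor with coefficients $a_0,\dots,a_7$ (smooth functions on $M$) is $$\mathcal{T}(X_1,X_2)X_3=a_0R(X_1,X_2)X_3+a_1S(X_2,X_3)X_1+a_2S(X_1,X_3)X_2+a_3S(X_1,X_2)X_3+a_4g(X_2,X_3)QX_1+a_5g(X_1,X_3)QX_2+a_6g(X_1,X_2)QX_3+a_7r\bigl(g(X_2,X_3)X_1-g(X_1,X_3)X_2\bigr).$$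 Special cases (coefficients not listed are $0$; $a_0=1$ except for $\mathcal{C}_\star$, where $a_0,a_1$ are free): $\mathcal{C}_\star$ (quasi-conformal): $a_1=-a_2=a_4=-a_5$, $a_7=-\frac1{2n+1}(\frac{a_0}{2n}+2a_1)$; $\mathcal{C}$ (conformal): $a_1=-a_2=a_4=-a_5=-\frac1{2n-1}$, $a_7=\frac1{2n(2n-1)}$; $\mathcal{L}$ (conharmonic): $a_1=-a_2=a_4=-a_5=-\frac1{2n-1}$; $\mathcal{M}$ ($M$-projective): $a_1=-a_2=a_4=-a_5=-\frac1{4n}$; $\mathcal{W}_2$: $a_4=-a_5=-\frac1{2n}$; $\mathcal{W}_3$: $a_2=-a_4=-\frac1{2n}$; $\mathcal{W}_7$: $a_1=-a_4=-\frac1{2n}$; $\mathcal{W}_9$: $a_3=-a_4=\frac1{2n}$. *)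

(* Defs.v *)
From HB Require Import structures.
From mathcomp Require Import all_boot all_order all_algebra.
From mathcomp Require Import all_classical all_reals all_analysis.

Set Implicit Arguments.
Unset Strict Implicit.
Unset Printing Implicit Defensive.

Import Order.TTheory GRing.Theory Num.Theory.
Import numFieldNormedType.Exports.

Local Open Scope classical_set_scope.
Local Open Scope ring_scope.

Section SmoothEuclidean.
Context {R : realType} {m : nat}.
Implicit Types (U : set 'rV[R]_m) (f g : 'rV[R]_m -> R).

(* Meaningful for U open: all iterated partial derivatives of order at most k
   exist and are continuous at every point of U. *)
Fixpoint Ck (k : nat) U f : Prop :=
  (forall x, U x -> {for x, continuous f}) /\
  if k is k'.+1 then
    forall i : 'I_m,
      (forall x, U x -> derivable f x (delta_mx 0 i)) /\
      Ck k' U ('D_(delta_mx 0 i) f)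
  else True.

Definition smooth_on U f : Prop := forall k, Ck k U f.

Lemma Ck_cont k U f x : Ck k U f -> U x -> {for x, continuous f}.
Proof. by case: k => [|k] [H _]; exact: H. Qed.

Lemma Ck_ext k U f g : open U -> (forall x, U x -> f x = g x) ->
  Ck k U f -> Ck k U g.
Proof.
move=> oU; have near_fg (u v : 'rV[R]_m -> R) x :
    (forall y, U y -> u y = v y) -> U x -> \forall z \near x, u z = v z.
  by move=> uv Ux; near=> z; apply: uv; near: z; exact: open_nbhs_nbhs.
have cont_fg (u v : 'rV[R]_m -> R) x : (forall y, U y -> u y = v y) -> U x ->
    {for x, continuous u} -> {for x, continuous v}.
  move=> uv Ux cu; rewrite /prop_for /continuous_at -(uv _ Ux).
  apply: cvg_trans cu.
  exact: (@near_eq_cvg _ _ (nbhs x) _ u v (near_fg _ _ _ uv Ux)).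
elim: k f g => [|k IH] f g fg [cf df].
  by split=> // x Ux; apply: cont_fg (cf x Ux).
split=> [x Ux|i]; first exact: cont_fg (cf x Ux).
have [di ci] := df i; split.
  by move=> x Ux; apply: near_eq_derivable (di x Ux); exact: near_fg.
by apply: IH ci => x Ux; apply: near_eq_derive; exact: near_fg.
Unshelve. all: by end_near. Qed.

Lemma CkW k U f : Ck k.+1 U f -> Ck k U f.
Proof.
elim: k f => [|k IH] f [cf df]; first by split.
by split=> // i; have [? ?] := df i; split=> //; exact: IH.
Qed.

Lemma Ck_cst k U (c : R) : open U -> Ck k U (fun=> c).
Proof.
move=> oU; elim: k c => [|k IH] c; split=> //.
- by move=> x _; exact: cst_continuous.
- by move=> x _; exact: cst_continuous.
move=> i; split; first by move=> x _; exact: derivable_cst.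
by apply: Ck_ext (IH 0) => // x _; rewrite derive_cst.
Qed.

Lemma CkD k U f g : open U -> Ck k U f -> Ck k U g -> Ck k U (f + g).
Proof.
move=> oU; elim: k f g => [|k IH] f g [cf df] [cg dg]; split=> //.
- by move=> x Ux; apply: continuousD; [exact: cf|exact: cg].
- by move=> x Ux; apply: continuousD; [exact: cf|exact: cg].
move=> i; have [df1 df2] := df i; have [dg1 dg2] := dg i; split.
  by move=> x Ux; apply: derivableD; [exact: df1|exact: dg1].
apply: Ck_ext (IH _ _ df2 dg2) => // x Ux.
by rewrite deriveD//; [exact: df1|exact: dg1].
Qed.

Lemma CkM k U f g : open U -> Ck k U f -> Ck k U g -> Ck k U (f * g).
Proof.
move=> oU; elim: k f g => [|k IH] f g Hf Hg.
  by split=> // x Ux; apply: continuousM; [exact: (Ck_cont Hf)|exact: (Ck_cont Hg)].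
have Hf' := CkW Hf; have Hg' := CkW Hg.
split; first by move=> x Ux; apply: continuousM;
  [exact: (Ck_cont Hf)|exact: (Ck_cont Hg)].
case: Hf => _ df; case: Hg => _ dg.
move=> i; have [df1 df2] := df i; have [dg1 dg2] := dg i; split.
  by move=> x Ux; apply: derivableM; [exact: df1|exact: dg1].
apply: Ck_ext (CkD oU (IH _ _ Hf' dg2) (IH _ _ Hg' df2)) => // x Ux.
by rewrite deriveM//; [exact: df1|exact: dg1].
Qed.

End SmoothEuclidean.

Section Manifold.
Context {R : realType} {m : nat}.

Record chart (T : topologicalType) := Chart {
  chart_dom : set T;
  chart_map : T -> 'rV[R]_m;
  chart_inv : 'rV[R]_m -> T;
  chart_dom_open : open chart_dom;
  chart_img_open : open (chart_map @` chart_dom);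
  chart_mapK : forall x, chart_dom x -> chart_inv (chart_map x) = x;
  chart_map_cont : forall x, chart_dom x -> {for x, continuous chart_map};
  chart_inv_cont : forall y, (chart_map @` chart_dom) y ->
    {for y, continuous chart_inv} }.

Definition compatible (T : topologicalType) (c d : chart T) : Prop :=
  forall j : 'I_m,
    smooth_on (chart_map c @` (chart_dom c `&` chart_dom d))
              (fun y => chart_map d (chart_inv c y) 0 j).

End Manifold.
Arguments chart : clear implicits.
Arguments chart_img_open {R m T} c.

(* Smooth m-dimensional manifold without boundary; the atlas need not be
   maximal, which does not affect the smooth functions. *)
Record manifold (R : realType) (m : nat) := Manifold {
  carrier :> topologicalType;
  carrier_hausdorff : hausdorff_space carrier;
  carrier_second_countable : @second_countable carrier;
  atlas : set (chart R m carrier);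
  atlas_cover : forall x : carrier, exists2 c, atlas c & chart_dom c x;
  atlas_compatible : forall c d, atlas c -> atlas d -> compatible c d }.

Section SmoothFunctions.
Context {R : realType} {m : nat} (M : manifold R m).

Definition smooth (f : M -> R) : Prop :=
  forall c : chart R m M, atlas c ->
    smooth_on (chart_map c @` chart_dom c) (f \o chart_inv c).

Definition smooth_pred : {pred M -> R} := mem [set f | smooth f].

Lemma smooth_cst (c : R) : smooth (fun=> c).
Proof. by move=> ch _ k; apply: Ck_cst; exact: chart_img_open. Qed.

Lemma smooth_subring : subring_closed smooth_pred.
Proof.
split; first by rewrite inE; exact: smooth_cst.
- move=> f g; rewrite !inE => sf sg c ac k.
  have oU := chart_img_open c.
  have -> : (f - g) \o chart_inv c =
      f \o chart_inv c + (fun=> -1) * (g \o chart_inv c).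
    by apply/funext => y; rewrite /= !fctE mulN1r.
  apply: CkD => //; first exact: sf.
  by apply: CkM => //; [exact: Ck_cst|exact: sg].
- move=> f g; rewrite !inE => sf sg c ac k.
  by apply: CkM; [exact: chart_img_open|exact: sf|exact: sg].
Qed.

HB.instance Definition _ :=
  GRing.isSubringClosed.Build (M -> R) smooth_pred smooth_subring.

Record smoothfun := SmoothFun {
  sf_fun :> M -> R;
  sf_smooth : sf_fun \in smooth_pred }.

HB.instance Definition _ := [isSub for sf_fun].
HB.instance Definition _ := [Choice of smoothfun by <:].
HB.instance Definition _ := 
  GRing.SubChoice_isSubComPzRing.Build _ _ smoothfun smooth_subring.

Definition sfcst (c : R) : smoothfun := SmoothFun (mem_set (smooth_cst c)).

Definition is_derivation (D : smoothfun -> smoothfun) : Prop :=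
  [/\ forall f g, D (f + g) = D f + D g,
      forall c f, D (sfcst c * f) = sfcst c * D f &
      forall f g, D (f * g) = D f * g + f * D g].

(* Functions into the regular module: this gives derivations their
   pointwise structure of module over smooth functions. *)
Definition derivation_pred : {pred smoothfun -> smoothfun^o} :=
  mem [set D | is_derivation D].

Lemma derivation_submod : submod_closed derivation_pred.
Proof.
split.
  rewrite inE; split.
  - by move=> f g; rewrite /= addr0.
  - by move=> c f; rewrite /= mulr0.
  - by move=> f g; rewrite /= mul0r mulr0 addr0.
move=> a D E; rewrite !inE => -[D1 D2 D3] [E1 E2 E3]; split.
- move=> f g; change (a * D (f + g) + E (f + g) =
    a * D f + E f + (a * D g + E g)).
  by rewrite D1 E1 mulrDr addrACA.
- move=> c f; change (a * D (sfcst c * f) + E (sfcst c * f) =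
    sfcst c * (a * D f + E f)).
  by rewrite D2 E2 mulrDr mulrCA.
- move=> f g; change (a * D (f * g) + E (f * g) =
    (a * D f + E f) * g + f * (a * D g + E g)).
  rewrite D3 E3 !mulrDr !mulrDl -!mulrA addrACA.
  by rewrite (mulrCA a f (D g)).
Qed.

HB.instance Definition _ := GRing.isSubmodClosed.Build
  smoothfun (smoothfun -> smoothfun^o) derivation_pred derivation_submod.

(* Smooth vector fields, as the derivations of the algebra of smooth
   functions; X f p is the derivative of f at p along X. *)
Record vfield := VField {
  vf_fun :> smoothfun -> smoothfun^o;
  vf_derivation : vf_fun \in derivation_pred }.

HB.instance Definition _ := [isSub for vf_fun].
HB.instance Definition _ := [Choice of vfield by <:].
HB.instance Definition _ := [SubChoice_isSubLmodule of vfield by <:].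

Lemma bracket_subproof (X Y : vfield) :
  (fun f => X (Y f) - Y (X f)) \in derivation_pred.
Proof.
have := vf_derivation X; have := vf_derivation Y; rewrite !inE.
move=> [Y1 Y2 Y3] [X1 X2 X3]; split.
- by move=> f g; rewrite Y1 X1 X1 Y1 opprD addrACA.
- by move=> c f; rewrite Y2 X2 X2 Y2 mulrBr.
- move=> f g; rewrite Y3 X3 X1 Y1 !X3 !Y3 mulrBl mulrBr.
  have aux (V : zmodType) (a b c d e h : V) :
      (a + b + (c + d)) - (e + c + (b + h)) = (a - e) + (d - h).
    rewrite -[a + b]addrC (addrACA b a c d) -[e + c]addrC (addrACA c e b h).
    by rewrite (addrC c b) opprD (addrACA (b + c)) subrr add0r opprD addrACA.
  exact: aux.
Qed.

Definition bracket (X Y : vfield) : vfield := VField (bracket_subproof X Y).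

End SmoothFunctions.

Section Geometry.
Context {R : realType} {m : nat} {M : manifold R m}.
Local Notation C := (smoothfun M).
Local Notation VF := (vfield M).
Implicit Types (X Y Z V xi : VF) (p : M) (f : C).
Implicit Types (phi Q : VF -> VF) (eta : VF -> C) (g S : VF -> VF -> C).
Implicit Type nabla : VF -> VF -> VF.

Definition vanishes_at X p : Prop := forall f, (X f : C) p = 0.

Definition riemannian_metric g : Prop :=
  [/\ forall X, scalar (g X),
      forall X Y, g X Y = g Y X,
      forall X p, 0 <= g X X p &
      forall X p, g X X p = 0 -> vanishes_at X p].

Definition affine_connection nabla : Prop :=
  [/\ forall Y, linear (nabla ^~ Y),
      forall X Y Z, nabla X (Y + Z) = nabla X Y + nabla X Z &
      forall X f Y, nabla X (f *: Y) = (X f : C) *: Y + f *: nabla X Y].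

Definition levi_civita g nabla : Prop :=
  [/\ affine_connection nabla,
      forall X Y, nabla X Y - nabla Y X = bracket X Y &
      forall X Y Z, X (g Y Z) = g (nabla X Y) Z + g Y (nabla X Z)].

Definition curvature nabla X Y Z : VF :=
  nabla X (nabla Y Z) - nabla Y (nabla X Z) - nabla (bracket X Y) Z.

Definition orthonormal_at g p (E : 'I_m -> VF) : Prop :=
  forall i j, g (E i) (E j) p = (i == j)%:R.

(* S(X, Y) is the trace of Z |-> R(Z, X)Y; vector fields orthonormal at p
   are as many as the dimension, so their values form a basis at p. *)
Definition ricci_tensor g nabla S : Prop :=
  forall X Y p (E : 'I_m -> VF), orthonormal_at g p E ->
    S X Y p = \sum_(i < m) g (curvature nabla (E i) X Y) (E i) p.

Definition ricci_operator g S Q : Prop :=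
  forall X Y, S X Y = g (Q X) Y.

Definition scalar_curvature g S (r : C) : Prop :=
  forall p (E : 'I_m -> VF), orthonormal_at g p E ->
    r p = \sum_(i < m) S (E i) (E i) p.

(* Exterior derivative with the factor 1/2; without it the condition
   d eta(X, Y) = g(X, phi Y) would define a different normalisation of the
   contact metric (Sasakian manifolds would not have kappa = 1). *)
Definition dform eta X Y : C :=
  sfcst M 2^-1 *
    ((X (eta Y) : C) - (Y (eta X) : C) - eta (bracket X Y)).

Definition lie_derivative_endo xi phi X : VF :=
  bracket xi (phi X) - phi (bracket xi X).

Definition hop xi phi X : VF :=
  sfcst M 2^-1 *: lie_derivative_endo xi phi X.

Record contact_metric phi xi eta g : Prop := ContactMetric {
  phi_linear : linear phi;
  eta_linear : scalar eta;
  g_riemannian : riemannian_metric g;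
  phi_sqr : forall X, phi (phi X) = - X + eta X *: xi;
  eta_xi : eta xi = 1;
  phi_xi : phi xi = 0;
  eta_phi : forall X, eta (phi X) = 0;
  g_phi : forall X Y, g (phi X) (phi Y) = g X Y - eta X * eta Y;
  deta : forall X Y, dform eta X Y = g X (phi Y) }.

Definition kappa_nullity xi eta nabla (kappa : R) : Prop :=
  forall X Y,
    curvature nabla X Y xi = sfcst M kappa *: (eta Y *: X - eta X *: Y).

(* S = b1 g + b2 eta (x) eta *)
Definition ricci_form eta g S (b1 b2 : M -> R) : Prop :=
  forall X Y p, S X Y p = b1 p * g X Y p + b2 p * (eta X p * eta Y p).

Definition eta_einstein eta g S : Prop :=
  exists b1 b2 : C, ricci_form eta g S b1 b2.

Definition einstein eta g S : Prop :=
  exists b1 : C, ricci_form eta g S b1 (fun=> 0).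

Record tcoef := TCoef {
  ta0 : C; ta1 : C; ta2 : C; ta3 : C; ta4 : C; ta5 : C; ta6 : C; ta7 : C }.

Definition tcurvature (a : tcoef) g nabla S Q (r : C) X1 X2 X3 : VF :=
  ta0 a *: curvature nabla X1 X2 X3
  + (ta1 a * S X2 X3) *: X1 + (ta2 a * S X1 X3) *: X2
  + (ta3 a * S X1 X2) *: X3
  + (ta4 a * g X2 X3) *: Q X1 + (ta5 a * g X1 X3) *: Q X2
  + (ta6 a * g X1 X2) *: Q X3
  + (ta7 a * r) *: (g X2 X3 *: X1 - g X1 X3 *: X2).

Definition xi_tflat (a : tcoef) xi g nabla S Q (r : C) : Prop :=
  forall X1 X2, tcurvature a g nabla S Q r X1 X2 xi = 0.

End Geometry.
Arguments tcoef {R m} M.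

Section OddDimension.
Context {R : realType} (n : nat) (M : manifold R (2 * n).+1).
Local Notation C := (smoothfun M).
Local Notation VF := (vfield M).
Implicit Types (kappa : R) (a : tcoef M).
Local Notation N := (n%:R : R).

(* Consequences of the N(kappa) condition when kappa < 1; the first and the
   last fail for general Sasakian manifolds (kappa = 1). *)
Record standing_formulas phi xi eta g (S : VF -> VF -> C) (r : C) kappa :
    Prop := StandingFormulas {
  standing_ricci : forall X Y,
    S X Y = sfcst M (2 * (N - 1)) * g X Y
            + sfcst M (2 * (N - 1)) * g (hop xi phi X) Y
            + sfcst M (2 * N * kappa - 2 * (N - 1)) * (eta X * eta Y);
  standing_ricci_xi : forall X, S X xi = sfcst M (2 * N * kappa) * eta X;
  standing_scalar : r = sfcst M (2 * N * (2 * N - 2 + kappa)) }.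

Definition A3 a kappa : M -> R := fun p =>
  ta0 a p * kappa + 2 * N * kappa * ta1 a p
  + 2 * N * (2 * N - 2 + kappa) * ta7 a p.

Definition B3 a kappa : M -> R := fun p =>
  - ta0 a p * kappa + 2 * N * kappa * (ta2 a p + ta3 a p + ta5 a p + ta6 a p)
  - 2 * N * (2 * N - 2 + kappa) * ta7 a p.

Definition quasi_conformal (a0 a1 : C) : tcoef M :=
  TCoef a0 a1 (- a1) 0 a1 (- a1) 0
    (sfcst M (- (2 * N + 1)^-1) * (sfcst M (2 * N)^-1 * a0 + a1 *+ 2)).

Definition conformal : tcoef M :=
  let c := sfcst M (- (2 * N - 1)^-1) in
  TCoef 1 c (- c) 0 c (- c) 0 (sfcst M (2 * N * (2 * N - 1))^-1).

Definition conharmonic : tcoef M :=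
  let c := sfcst M (- (2 * N - 1)^-1) in
  TCoef 1 c (- c) 0 c (- c) 0 0.

Definition m_projective : tcoef M :=
  let c := sfcst M (- (4 * N)^-1) in
  TCoef 1 c (- c) 0 c (- c) 0 0.

Definition W2 : tcoef M :=
  let c := sfcst M (- (2 * N)^-1) in TCoef 1 0 0 0 c (- c) 0 0.

Definition W3 : tcoef M :=
  let c := sfcst M (- (2 * N)^-1) in TCoef 1 0 c 0 (- c) 0 0 0.

Definition W7 : tcoef M :=
  let c := sfcst M (- (2 * N)^-1) in TCoef 1 c 0 0 (- c) 0 0 0.

Definition W9 : tcoef M :=
  let c := sfcst M (2 * N)^-1 in TCoef 1 0 0 c (- c) 0 0 0.

End OddDimension.

(* Main.v *)
Require Import Defs.
From HB Require Import structures.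
From mathcomp Require Import all_boot all_order all_algebra.
From mathcomp Require Import all_classical all_reals all_analysis.
From mathcomp Require Import ring.

Set Implicit Arguments.
Unset Strict Implicit.
Unset Printing Implicit Defensive.

Import Order.TTheory GRing.Theory Num.Theory.
Import numFieldNormedType.Exports.

Local Open Scope ring_scope.

(** Evaluate the flatness condition at [X2 = xi] and pair it with an arbitrary
    field [Y].  The nullity condition turns [R(X, xi) xi] into
    [kappa (X - eta(X) xi)], the compatibility of [g] with [phi] gives
    [g(X, xi) = eta(X)], and [S(X, xi) = S(xi, X) = 2 n kappa eta(X)].  So in
    [g(T(X, xi) xi, Y) = 0] every term is a multiple of [g(X, Y)] or of
    [eta(X) eta(Y)], except [a4 g(Q X, Y) = a4 S(X, Y)]; collecting
    coefficients gives [a4 S = - A3 g - B3 eta (x) eta]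
    ([xi_tflat_ricci]), and one divides by [a4].

    Being eta-Einstein also asks for smooth coefficients, which requires the
    inverse of a nowhere vanishing smooth function to be smooth
    ([smoothV]).  The particular tensors are then a matter of evaluating [A3]
    and [B3]; their denominators are nonzero because [n > 0]. *)

(** * Inverses of nowhere vanishing smooth functions *)

(** The induction runs on the order of differentiability: the partial
    derivatives of [1 / f] are [- (1 / f) * (1 / f)] times those of [f], so
    they are of class [C^k] as soon as [1 / f] itself is. *)
Lemma CkV (R : realType) (m k : nat) (U : set 'rV[R]_m) (f : 'rV[R]_m -> R) :
  open U -> (forall x, U x -> f x != 0) -> Ck k U f ->
  Ck k U (fun x => (f x)^-1).
Proof.
move=> oU nz; elim: k => [|k IH] Hf.
  by split=> // x Ux; apply: continuousV; [exact: nz|exact: (Ck_cont Hf)].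
have HV := IH (CkW Hf).
split; first by move=> x Ux; apply: continuousV; [exact: nz|exact: (Ck_cont Hf)].
case: Hf => _ df i; have [df1 df2] := df i; split.
  by move=> x Ux; apply: derivableV; [exact: nz|exact: df1].
apply: Ck_ext (CkM oU (CkM oU (Ck_cst k (-1) oU) (CkM oU HV HV)) df2) => // x Ux.
rewrite deriveV; [|exact: nz|exact: df1].
by rewrite /= !fctE mulN1r -invfM -expr2.
Qed.

Lemma smoothV (R : realType) (m : nat) (M : manifold R m) (f : M -> R) :
  (forall p, f p != 0) -> smooth f -> smooth (fun p => (f p)^-1).
Proof.
move=> nz sf c ac k; apply: (CkV (chart_img_open c) _ (sf c ac k)) => x _.
exact: nz.
Qed.

Definition sfinv (R : realType) (m : nat) (M : manifold R m) (f : smoothfun M)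
    (nz : forall p, f p != 0) : smoothfun M :=
  SmoothFun (mem_set (smoothV nz (set_mem (sf_smooth f)))).

(** Simplification would turn a product of smooth functions into one of plain
    functions, still applied to the point; this rule pushes the evaluation down
    to the atoms, where [ring] and [field] can work. *)
Lemma sfE (R : realType) (m : nat) (M : manifold R m) :
  (((forall (f g : smoothfun M) p, (f + g) p = f p + g p) *
    (forall (f g : smoothfun M) p, (f * g) p = f p * g p)) *
   ((forall (f : smoothfun M) p, (- f) p = - f p) *
    (forall (f : smoothfun M) k p, (f *+ k) p = f p *+ k))) *
  (((forall p, (0 : smoothfun M) p = 0) * (forall p, (1 : smoothfun M) p = 1)) *
   ((forall c p, sfcst M c p = c) *
    (forall (f : smoothfun M) nz p, sfinv (f := f) nz p = (f p)^-1))).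
Proof.
by do !split=> //; move=> f k p; elim: k => [|k IH] //; rewrite !mulrS -IH.
Qed.

(** * The characteristic vector field of a contact metric structure *)

Section ContactMetric.
Context {R : realType} {m : nat} {M : manifold R m}.
Implicit Types (X Y Z : vfield M) (p : M).
Context {phi : vfield M -> vfield M} {xi : vfield M}
  {eta : vfield M -> smoothfun M} {g : vfield M -> vfield M -> smoothfun M}
  (hcm : contact_metric phi xi eta g).

Lemma metricDr X Y Z : g X (Y + Z) = g X Y + g X Z.
Proof.
by have [/(_ X) gl _ _ _] := g_riemannian hcm;
   rewrite -[Y]scale1r gl mul1r scale1r.
Qed.

Lemma metric0r X : g X 0 = 0.
Proof. by apply: (addIr (g X 0)); rewrite -metricDr !add0r. Qed.

Lemma metricZr X (f : smoothfun M) Y : g X (f *: Y) = f * g X Y.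
Proof.
have [/(_ X) gl _ _ _] := g_riemannian hcm.
by rewrite -[f *: Y]addr0 gl metric0r addr0.
Qed.

Lemma metricNr X Y : g X (- Y) = - g X Y.
Proof. by rewrite -scaleN1r metricZr mulN1r. Qed.

Lemma metricC X Y : g X Y = g Y X.
Proof. by have [_ gC _ _] := g_riemannian hcm. Qed.

(** Compatibility of [g] with [phi], at the pair [(X, xi)]: the left-hand side
    is [0] since [phi xi = 0]. *)
Lemma metric_xi X : g X xi = eta X.
Proof.
have := g_phi hcm X xi; rewrite (phi_xi hcm) metric0r (eta_xi hcm) mulr1.
by move=> /esym/eqP; rewrite subr_eq0 => /eqP.
Qed.

Lemma hop_xi : hop xi phi xi = 0.
Proof.
have phi0 : phi 0 = 0.
  have := phi_linear hcm 1 0 0; rewrite !scale1r !addr0 => H.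
  by apply: (addIr (phi 0)); rewrite -H add0r.
have br0 : bracket xi 0 = 0.
  apply/val_inj/funext => f /=; have := vf_derivation xi; rewrite inE.
  move=> [D1 _ _]; rewrite subr0.
  by apply: (addIr (xi 0)); rewrite -D1 !add0r.
have brxi : bracket xi xi = 0 by apply/val_inj/funext => f /=; rewrite subrr.
by rewrite /hop /lie_derivative_endo (phi_xi hcm) br0 brxi phi0 subrr scaler0.
Qed.

End ContactMetric.

(** * Xi-flatness determines the Ricci tensor *)

Section XiFlat.
Context {R : realType} {n : nat} {M : manifold R (2 * n).+1}.
Implicit Types (X Y : vfield M) (p : M).
Context {phi : vfield M -> vfield M} {xi : vfield M}
  {eta : vfield M -> smoothfun M} {g : vfield M -> vfield M -> smoothfun M}
  (hcm : contact_metric phi xi eta g)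
  {nabla : vfield M -> vfield M -> vfield M}
  {S : vfield M -> vfield M -> smoothfun M}
  {Q : vfield M -> vfield M} (hQ : ricci_operator g S Q)
  {r : smoothfun M} {kappa : R}
  (hkappa : kappa_nullity xi eta nabla kappa)
  (hst : standing_formulas phi xi eta g S r kappa).
Local Notation N := (n%:R : R).

(** With [xi] in the first slot, as it occurs in [g (Q xi) Y]; it holds because
    [h xi = 0] kills the middle term of the formula for [S]. *)
Lemma ricci_xil Y : S xi Y = sfcst M (2 * N * kappa) * eta Y.
Proof.
rewrite (standing_ricci hst) (hop_xi hcm) (metricC hcm 0) (metric0r hcm) mulr0.
rewrite (metricC hcm xi) (metric_xi hcm) (eta_xi hcm) mul1r addr0 -mulrDl.
congr (_ * _); apply/val_inj/funext => p /=.
by rewrite fctE addrC subrK.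
Qed.

(** Pairing [T(X, xi) xi = 0] with [Y]: only the term [a4 Q X] contributes
    an unknown, every other one being a multiple of [g] or [eta (x) eta]. *)
Lemma xi_tflat_ricci (a : tcoef M) X Y p :
  xi_tflat a xi g nabla S Q r ->
  ta4 a p * S X Y p =
    - A3 a kappa p * g X Y p - B3 a kappa p * (eta X p * eta Y p).
Proof.
move=> flat; have := congr1 (fun Z => g Y Z p) (flat X xi).
rewrite /tcurvature hkappa (metric0r hcm) !(metricDr hcm) !(metricZr hcm).
rewrite !(metricDr hcm) !(metricNr hcm) !(metricZr hcm).
rewrite !(metric_xi hcm) (eta_xi hcm) !(metricC hcm Y) -!hQ.
rewrite !ricci_xil !(standing_ricci_xi hst).
rewrite (standing_scalar hst) (eta_xi hcm) !sfE => H0.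
apply/eqP; rewrite -subr_eq0 -[X in _ == X]H0; apply/eqP.
by rewrite /A3 /B3; ring.
Qed.

Lemma xi_tflat_ricci_form (a : tcoef M) :
  xi_tflat a xi g nabla S Q r -> (forall p, ta4 a p != 0) ->
  ricci_form eta g S (fun p => - A3 a kappa p / ta4 a p)
                     (fun p => - B3 a kappa p / ta4 a p).
Proof.
move=> flat nz X Y p; apply: (mulfI (nz p)); rewrite (xi_tflat_ricci X Y p flat).
by field; exact: nz.
Qed.

(** Smoothness of the two coefficients rests on that of [1 / a4]. *)
Lemma xi_tflat_eta_einstein (a : tcoef M) :
  xi_tflat a xi g nabla S Q r -> (forall p, ta4 a p != 0) ->
  eta_einstein eta g S.
Proof.
move=> flat nz.
exists (- (ta0 a * sfcst M kappa + sfcst M (2 * N * kappa) * ta1 a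
           + sfcst M (2 * N * (2 * N - 2 + kappa)) * ta7 a) * sfinv nz).
exists (- (- ta0 a * sfcst M kappa
           + sfcst M (2 * N * kappa) * (ta2 a + ta3 a + ta5 a + ta6 a)
           - sfcst M (2 * N * (2 * N - 2 + kappa)) * ta7 a) * sfinv nz).
by move=> X Y p; rewrite (xi_tflat_ricci_form flat nz) !sfE.
Qed.

Lemma xi_tflat_special (a : tcoef M) (b1 b2 : M -> R) :
  xi_tflat a xi g nabla S Q r -> (forall p, ta4 a p != 0) ->
  (forall p, - A3 a kappa p / ta4 a p = b1 p) ->
  (forall p, - B3 a kappa p / ta4 a p = b2 p) ->
  ricci_form eta g S b1 b2 /\ eta_einstein eta g S.
Proof.
move=> flat nz hb1 hb2; split; last exact: xi_tflat_eta_einstein flat nz.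
by move=> X Y p; rewrite (xi_tflat_ricci_form flat nz) hb1 hb2.
Qed.

Lemma xi_tflat_special_einstein (a : tcoef M) (b : R) :
  xi_tflat a xi g nabla S Q r -> (forall p, ta4 a p != 0) ->
  (forall p, - A3 a kappa p / ta4 a p = b) ->
  (forall p, - B3 a kappa p / ta4 a p = 0) ->
  ricci_form eta g S (fun=> b) (fun=> 0) /\ einstein eta g S.
Proof.
move=> flat nz hb1 hb2; have [rf _] := xi_tflat_special flat nz hb1 hb2.
by split=> //; exists (sfcst M b).
Qed.

End XiFlat.

(* The delta list keeps the operations on smooth functions folded. *)
Ltac unfold_coefs :=
  cbv beta iota zeta delta
    [A3 B3 quasi_conformal conformal conharmonic m_projective W2 W3 W7 W9
     ta0 ta1 ta2 ta3 ta4 ta5 ta6 ta7];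
  rewrite ?sfE.

Theorem theorem4 (R : realType) (n : nat) (n_gt0 : (0 < n)%N)
  (M : manifold R (2 * n).+1)
  (phi : vfield M -> vfield M) (xi : vfield M)
  (eta : vfield M -> smoothfun M) (g : vfield M -> vfield M -> smoothfun M)
  (hcm : contact_metric phi xi eta g)
  (nabla : vfield M -> vfield M -> vfield M) (hnabla : levi_civita g nabla)
  (S : vfield M -> vfield M -> smoothfun M) (hS : ricci_tensor g nabla S)
  (Q : vfield M -> vfield M) (hQ : ricci_operator g S Q)
  (r : smoothfun M) (hr : scalar_curvature g S r)
  (kappa : R) (hkappa : kappa_nullity xi eta nabla kappa)
  (hst : standing_formulas phi xi eta g S r kappa) :
  let N : R := n%:R in
  (forall a : tcoef M,
     xi_tflat a xi g nabla S Q r -> (forall p : M, ta4 a p != 0) ->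
     ricci_form eta g S (fun p => - A3 a kappa p / ta4 a p)
                        (fun p => - B3 a kappa p / ta4 a p)
     /\ eta_einstein eta g S) /\
  (forall a0 a1 : smoothfun M,
     xi_tflat (quasi_conformal a0 a1) xi g nabla S Q r ->
     (forall p : M, a1 p != 0) ->
     ricci_form eta g S
       (fun p => ((kappa + 2 * N - 2) * (4 * N * a1 p + a0 p) / (2 * N + 1)
                  - 2 * N * kappa * a1 p - kappa * a0 p) / a1 p)
       (fun p => 2 * ((kappa - 1) * N + 1) * (4 * N * a1 p + a0 p)
                  / ((2 * N + 1) * a1 p))
     /\ eta_einstein eta g S) /\
  (xi_tflat (conformal M) xi g nabla S Q r ->
     ricci_form eta g S (fun=> 2 * N - 2) (fun=> 2 * (N * kappa - N + 1))
     /\ eta_einstein eta g S) /\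
  (xi_tflat (conharmonic M) xi g nabla S Q r ->
     ricci_form eta g S (fun=> - kappa) (fun=> 2 * N * kappa + kappa)
     /\ eta_einstein eta g S) /\
  (xi_tflat (m_projective M) xi g nabla S Q r ->
     ricci_form eta g S (fun=> 2 * N * kappa) (fun=> 0)
     /\ einstein eta g S) /\
  (xi_tflat (W2 M) xi g nabla S Q r ->
     ricci_form eta g S (fun=> 2 * N * kappa) (fun=> 0)
     /\ einstein eta g S) /\
  (xi_tflat (W9 M) xi g nabla S Q r ->
     ricci_form eta g S (fun=> 2 * N * kappa) (fun=> 0)
     /\ einstein eta g S) /\
  (xi_tflat (W3 M) xi g nabla S Q r ->
     ricci_form eta g S (fun=> - (2 * N * kappa)) (fun=> 4 * N * kappa)
     /\ eta_einstein eta g S) /\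
  (xi_tflat (W7 M) xi g nabla S Q r ->
     ricci_form eta g S (fun=> 0) (fun=> 2 * N * kappa)
     /\ eta_einstein eta g S).
Proof.
have N0 : (n%:R : R) != 0 by rewrite pnatr_eq0 -lt0n.
have invN k : (k.+1%:R * (n%:R : R))^-1 != 0.
  by rewrite invr_eq0 mulf_neq0 ?pnatr_eq0 // -lt0n.
have N1 : 2 * (n%:R : R) - 1 != 0.
  rewrite subr_eq0 -natrM (eqr_nat _ _ 1).
  by case: (n) n_gt0 => // k _; rewrite mulnS.
have N2 : 2 * (n%:R : R) + 1 != 0 by rewrite -natrM natr1 pnatr_eq0.
move=> N.
have spec := xi_tflat_special hcm hQ hkappa hst.
have espec := xi_tflat_special_einstein hcm hQ hkappa hst.
split; first by move=> a flat nz; exact: spec.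
split.
  by move=> a0 a1 flat nz; apply: (spec _ _ _ flat nz) => p;
    unfold_coefs; field; rewrite nz N2 N0.
split.
  by move=> flat; apply: (spec _ _ _ flat) => p; unfold_coefs;
    [rewrite oppr_eq0 invr_eq0|field; rewrite N0 N1..].
split.
  by move=> flat; apply: (spec _ _ _ flat) => p; unfold_coefs;
    [rewrite oppr_eq0 invr_eq0|field; rewrite N1..].
split.
  by move=> flat; apply: (espec _ _ flat) => p; unfold_coefs;
    [rewrite oppr_eq0 invN|field; rewrite N0..].
split.
  by move=> flat; apply: (espec _ _ flat) => p; unfold_coefs;
    [rewrite oppr_eq0 invN|field; rewrite N0..].
split.
  by move=> flat; apply: (espec _ _ flat) => p; unfold_coefs;
    [rewrite oppr_eq0 invN|field; rewrite N0..].
split.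
  by move=> flat; apply: (spec _ _ _ flat) => p; unfold_coefs;
    [rewrite opprK invN|field; rewrite N0..].
by move=> flat; apply: (spec _ _ _ flat) => p; unfold_coefs;
  [rewrite opprK invN|field; rewrite N0..].
Qed.
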